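(* Let $M$ be a compact metrizable space, and let $X$ be a closed subset of $M^{\omega_1}$. For $\alpha\le\omega_1$ let $X_\alpha=\pi^{\omega_1}_\alpha(X)$. Assume that for each $\alpha<\omega_1$, the map $\pi^{\alpha+1}_\alpha{\upharpoonright} X_{\alpha+1}: X_{\alpha+1}\to X_\alpha$ (which is onto) is tight. Then: 1. For each $\alpha<\beta\le\omega_1$, the map $\pi^\beta_\alpha{\upharpoonright} X_\beta:X_\beta\to X_\alpha$ is tight. 2. $X$ is dissipated.
   Context: For ordinals $\alpha\le\beta$, $\pi^\beta_\alpha:M^\beta\to M^\alpha$ denotes the natural projection (restriction to the first $\alpha$ coordinates). All spaces are Hausdorff; $f:X\to Y$ always denotes a continuous map. A subset of a space is perfect iff it is closed, non-empty and has no isolated points; a space is scattered iff it has no perfect subsets. Let $X,Y$ be compact and $f:X\to Y$. A loose family for $f$ is a disjoint family $\mathcal P$ of closed subsets of $X$ such that for some non-scattered $Q\subseteq Y$, $Q=f(P)$ for all $P\in\mathcal P$. The map $f$ is tight iff there is no loose family for $f$ of size $2$. For compact $X,Y,Z$, $f:X\to Y$ and $g:X\to Z$, $f$ is finer than $g$ iff there is a continuous $\Gamma:f(X)\to g(X)$ with $g=\Gamma\circ f$. $X$ is dissipated iff $X$ is compact and whenever $g:X\to Z$ with $Z$ compact metrizable, there is a tight $f:X\to Y$, for some compact metrizable $Y$, that is finer than $g$. *)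

(* Defs.v *)
From HB Require Import structures.
From mathcomp Require Import all_boot all_order all_algebra.
From mathcomp Require Import all_classical all_reals all_analysis.
From mathcomp Require Import wochoice.

Set Implicit Arguments.
Unset Strict Implicit.
Unset Printing Implicit Defensive.

Import Order.TTheory GRing.Theory Num.Theory.

Local Open Scope classical_set_scope.
Local Open Scope ring_scope.

(* Throughout, a subset [A] of a space is regarded as a space through
   [set_type A], which carries the subspace topology. *)

(* [perfect_set] of the library allows the empty set. *)
Definition perfect (T : topologicalType) (A : set T) : Prop :=
  [/\ closed A, A !=set0 & isolated A = set0].

Definition scattered (T : topologicalType) : Prop :=
  ~ exists A : set T, perfect A.

Definition metrizable (R : realType) (T : topologicalType) : Prop :=
  exists d : T -> T -> R,
    [/\ forall x y, d x y = 0 <-> x = y,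
        forall x y, d x y = d y x,
        forall x y z, d x z <= d x y + d y z
      & forall x, nbhs x = nbhs_ball_ (fun y e => [set z | d y z < e]) x].

Section Maps.
Context {X Y : topologicalType}.

(* [loose_family] and [tight] are meant for continuous [f] between compact
   Hausdorff spaces. *)
Definition loose_family (f : X -> Y) (P : set (set X)) : Prop :=
  [/\ trivIset P id,
      forall A, P A -> closed A
    & exists Q : set Y, ~ scattered (set_type Q) /\ forall A, P A -> Q = f @` A].

Definition tight (f : X -> Y) : Prop :=
  ~ exists P : set (set X), loose_family f P /\ (P #= `I_2)%card.

Definition to_range (f : X -> Y) (x : X) : set_type (range f) :=
  SigSub (mem_set (imageT f x)).

End Maps.

Definition finer (X Y Z : topologicalType) (f : X -> Y) (g : X -> Z) : Prop :=
  exists Gamma : set_type (range f) -> set_type (range g),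
    continuous Gamma /\ to_range g = Gamma \o to_range f.

Definition dissipated (R : realType) (X : topologicalType) : Prop :=
  [/\ compact [set: X],
      hausdorff_space X
    & forall (Z : topologicalType) (g : X -> Z),
        compact [set: Z] -> metrizable R Z -> continuous g ->
        exists (Y : topologicalType) (f : X -> Y),
          [/\ compact [set: Y], metrizable R Y, continuous f, tight f
            & finer f g]].

(* Ordinals are the elements of a well-ordered type [W], each element [a]
   being identified with the set of its predecessors. *)
Section Ordinals.
Context {d : Order.disp_t} {W : orderType d}.

Definition is_omega1 (w : W) : Prop :=
  ~ countable [set b : W | (b < w)%O] /\
  forall a : W, (a < w)%O -> countable [set b : W | (b < a)%O].

(* s = a + 1 *)
Definition is_succ (a s : W) : Prop :=
  (a < s)%O /\ forall b : W, (a < b)%O -> (s <= b)%O.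

Definition seg (a : W) : Type := {b : W | (b < a)%O}.

Definition widen_seg (a b : W) (le_ab : (a <= b)%O) (i : seg a) : seg b :=
  exist _ (sval i) (lt_le_trans (svalP i) le_ab).

Definition ordpow (M : topologicalType) (a : W) : topologicalType :=
  {ptws seg a -> M}.

Definition ordproj (M : topologicalType) (a b : W) (le_ab : (a <= b)%O)
    (x : ordpow M b) : ordpow M a :=
  fun i => x (widen_seg le_ab i).

Definition level (M : topologicalType) (w : W) (X : set (ordpow M w))
    (a : W) (le_aw : (a <= w)%O) : set (ordpow M a) :=
  ordproj le_aw @` X.

Lemma ordproj_level (M : topologicalType) (w : W) (X : set (ordpow M w))
    (a b : W) (le_ab : (a <= b)%O) (le_bw : (b <= w)%O) (y : ordpow M b) :
  level X le_bw y -> level X (le_trans le_ab le_bw) (ordproj le_ab y).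
Proof.
move=> [x Xx <-]; exists x => //; apply/funext => i; congr (x _).
exact/val_inj.
Qed.

(* the restriction of [ordproj le_ab] to a map X_b -> X_a *)
Definition level_proj (M : topologicalType) (w : W) (X : set (ordpow M w))
    (a b : W) (le_ab : (a <= b)%O) (le_bw : (b <= w)%O)
    (y : set_type (level X le_bw)) :
    set_type (level X (le_trans le_ab le_bw)) :=
  SigSub (mem_set (ordproj_level le_ab (set_valP y))).

End Ordinals.

Arguments level_proj {d W M w} X {a b} le_ab le_bw y.

(* Main.v *)
Require Import Defs.
From HB Require Import structures.
From mathcomp Require Import all_boot all_order all_algebra.
From mathcomp Require Import all_classical all_reals all_analysis.
From mathcomp Require Import wochoice.
From mathcomp Require Import lra.

(* Replacing the common image [Q] of a loose pair by a perfect subset of [Q], a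
   map is tight iff no two disjoint closed sets have the same image, closed,
   nonempty and without isolated points. All levels are quotients of [X], so
   such a pair for [X_b -> X_a] may be taken as two closed subsets of [X] with
   disjoint images in [X_b] and equal images in [X_a].

   Tightness is preserved by composition: given a pair for [X_b -> X_a] and
   [a < c < b], let [H] be the intersection of the two images in [X_c]. If [H]
   contains a perfect set, the pair restricts to one for [X_b -> X_c]. Otherwise
   the image of [H] in [X_a] is scattered, and away from it the pair restricts
   to one for [X_c -> X_a]. At a limit [b], compactness separates the two closed
   sets already at some level [c < b]. This gives the first part by induction.

   For the second part, compactness also shows that a map from [X] to a
   metrizable space depends on countably many coordinates only, hence factors
   through some [X_a] with [a < omega_1], and [M^a] is metrizable. *)

Set Implicit Arguments.
Unset Strict Implicit.
Unset Printing Implicit Defensive.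

Import Order.TTheory GRing.Theory Num.Theory.

Local Open Scope classical_set_scope.

(** * Closed images and subspaces of compact Hausdorff spaces *)

Lemma closed_image (S T : topologicalType) (f : S -> T) (A : set S) :
  compact [set: S] -> hausdorff_space T -> continuous f -> closed A ->
  closed (f @` A).
Proof.
move=> cS hT cf cA; apply: compact_closed => //.
apply: continuous_compact; first exact: continuous_subspaceT.
exact: subclosed_compact cA cS _.
Qed.

Lemma closed_preimage (S T : topologicalType) (f : S -> T) (A : set T) :
  continuous f -> closed A -> closed (f @^-1` A).
Proof. by move=> cf; apply: (continuous_closedP _).1. Qed.

Lemma set_val_continuous (T : topologicalType) (A : set T) :
  continuous (set_val : set_type A -> T).
Proof. exact: initial_continuous. Qed.

Lemma set_val_inj (T : Type) (A : set T) :
  injective (set_val : set_type A -> T).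
Proof. exact val_inj. Qed.

Lemma compact_set_type (T : topologicalType) (A : set T) :
  compact A -> compact [set: set_type A].
Proof.
move=> cA F FF _.
have FA : (set_val @ F) A.
  by rewrite /fmap/=; apply: filterS filterT => x _; exact: set_valP.
have [p [Ap clp]] := cA _ _ FA.
exists (exist _ p (mem_set Ap)); split => // B C FB [_ [[W oW <-] /= Wp sWC]].
have [|y [[x Bx <-] Wx]] := clp (set_val @` B) W _ (open_nbhs_nbhs (conj oW Wp)).
  by rewrite /fmap/=; apply: filterS FB => x Bx; exists x.
by exists x; split => //; exact: sWC.
Qed.

Lemma hausdorff_inj (S T : topologicalType) (f : S -> T) :
  continuous f -> injective f -> hausdorff_space T -> hausdorff_space S.
Proof.
move=> cf injf hT x y clxy; apply: injf; apply: hT => A B fxA fyB.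
have [z [Az Bz]] := clxy (f @^-1` A) (f @^-1` B) (cf _ _ fxA) (cf _ _ fyB).
by exists (f z).
Qed.

(** * Sets without isolated points, and tight maps *)

Definition crowded (T : topologicalType) (Q : set T) : Prop :=
  Q !=set0 /\
  forall x V, Q x -> nbhs x V -> exists y, [/\ Q y, V y & y <> x].

Lemma crowdedP (T : topologicalType) (Q : set T) :
  crowded Q <-> Q !=set0 /\ isolated Q = set0.
Proof.
split=> -[Q0 H]; split => //.
  apply/seteqP; split => // x [/set_mem Qx [V xV VQ]].
  have [y [Qy Vy]] := H _ _ Qx xV; apply.
  by have : (V `&` Q) y by []; rewrite VQ.
move=> x V Qx xV; apply: contrapT => noy.
have : isolated Q x; last by rewrite H.
split; first exact: mem_set.
exists V => //; apply/seteqP; split => [y [Vy Qy]|_ ->].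
  by apply: contrapT => yx; apply: noy; exists y.
by split => //; exact: nbhs_singleton.
Qed.

Lemma crowded_image (S T : topologicalType) (f : S -> T) (Q : set S) :
  continuous f -> injective f -> crowded Q -> crowded (f @` Q).
Proof.
move=> cf injf [[x0 Qx0] H]; split; first by exists (f x0), x0.
move=> _ V [x Qx <-] xV; have [y [Qy Vy yx]] := H _ _ Qx (cf _ _ xV).
by exists (f y); split => // /injf.
Qed.

(** Such an [f] is an embedding: for [U] open, the image of [~] [U] is closed and, by injectivity,
    misses [f x] when [x] is in [U]. *)
Lemma crowded_preimage (S T : topologicalType) (f : S -> T) (Q : set T) :
  compact [set: S] -> hausdorff_space T -> continuous f -> injective f ->
  Q `<=` range f -> crowded Q -> crowded (f @^-1` Q).
Proof.
move=> cS hT cf injf Qf [[q0 Qq0] H]; split.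
  by have [x _ xq] := Qf _ Qq0; exists x; rewrite /= xq.
move=> x V /= Qx; rewrite nbhsE => -[U [oU Ux] UV].
have [|y [Qy Uy yx]] := H (f x) (~` (f @` (~` U))) Qx.
  apply: open_nbhs_nbhs; split.
    by apply: closed_openC; apply: closed_image => //; exact: open_closedC.
  by move=> -[z + /injf zx]; rewrite zx.
have [z _ zy] := Qf _ Qy; exists z; rewrite /= zy; split => //.
  by apply: UV; apply: contrapT => Uz; apply: Uy; exists z.
by move=> zx; apply: yx; rewrite -zy zx.
Qed.

(* With [h = idfun] these are the loose families of size 2 for [f] whose common
   image has no isolated point; a general [h] allows a loose pair living in the
   quotient [range h] to be described by closed sets upstairs. *)
Definition loose_pair (S A B : topologicalType) (f : S -> A) (h : S -> B) :=
  exists P0 P1 : set S,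
    [/\ closed P0, closed P1, forall x y, P0 x -> P1 y -> h x <> h y,
        f @` P0 = f @` P1 & crowded (f @` P0)].

(** A crowded image of a closed set is compact, so the whole subspace is perfect in itself.
    Conversely, a perfect subset of the common image is cut out of both members by preimage. *)
Lemma tightP (S T : topologicalType) (f : S -> T) :
  compact [set: S] -> hausdorff_space T -> continuous f ->
  tight f <-> ~ loose_pair f idfun.
Proof.
move=> cS hT cf; split; apply: contra_not.
  move=> [P0 [P1 [cP0 cP1 nP01 P01 crP]]].
  have P010 : P0 `&` P1 = set0.
    by apply/seteqP; split => // x [P0x P1x]; case: (nP01 _ _ P0x P1x).
  exists [set P0; P1]; split; [split|].
  - by move=> i j [] -> [] -> //=; rewrite ?(setIC P1) P010 => -[].
  - by move=> A [] ->.
  - exists (f @` P0); split; last by move=> A [] ->.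
    apply; exists setT.
    have /crowdedP [? ?] : crowded [set: set_type (f @` P0)].
      have -> : [set: set_type (f @` P0)] = set_val @^-1` (f @` P0).
        by apply/seteqP; split => // x _; exact: (set_valP x).
      have cfP : compact (f @` P0).
        apply: continuous_compact; first exact: continuous_subspaceT.
        exact: subclosed_compact cP0 cS _.
      apply: crowded_preimage (crP) => //.
      - exact: compact_set_type.
      - exact: set_val_continuous.
      - by move=> x Px; exists (exist _ x (mem_set Px)).
    by split.
  - apply/card_esym/card_set_bijP; exists (fun n => if n == 0%N then P0 else P1).
    have P0n : P0 <> P1.
      move=> E; case: crP => -[_ [x Px _]] _.
      have : (P0 `&` P1) x by split => //; rewrite -E.
      by rewrite P010.
    split.
    + by move=> n _ /=; case: ifP => _; [left|right].
    + by move=> [|[|n]] [|[|m]] /set_mem //= _ /set_mem //= _ // /esym.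
    + by move=> _ [] ->; [exists 0%N|exists 1%N].
move=> [P [[triv cP [Q [nsc PQ]]] /card_esym/card_set_bijP[F [FP injF _]]]].
have PF0 : P (F 0%N) by exact: FP.
have PF1 : P (F 1%N) by exact: FP.
have F01 : F 0%N `&` F 1%N = set0.
  apply/eqP/negPn/negP => /set0P /(triv _ _ PF0 PF1) E.
  have /= : 0%N = 1%N :> nat by apply: injF; rewrite ?inE.
  by [].
move/contrapT: nsc => [K [cK K0 isoK]].
have cQ : compact Q.
  rewrite (PQ _ PF0); apply: continuous_compact.
    exact: continuous_subspaceT.
  by apply: subclosed_compact (cP _ PF0) cS _.
have clK : closed (set_val @` K).
  apply: closed_image => //; first exact: compact_set_type.
  exact: set_val_continuous.
have imK A : P A -> f @` (A `&` f @^-1` (set_val @` K)) = set_val @` K.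
  move=> PA; apply/seteqP; split => [_ [x [Ax Kx] <-] //|y Ky].
  have [x Ax xy] : (f @` A) y.
    by rewrite -(PQ _ PA); case: Ky => z _ <-; exact: (set_valP z).
  by exists x => //; split => //=; rewrite xy.
exists (F 0%N `&` f @^-1` (set_val @` K)), (F 1%N `&` f @^-1` (set_val @` K)).
split.
- by apply: closedI; [exact: cP|exact: closed_preimage].
- by apply: closedI; [exact: cP|exact: closed_preimage].
- move=> x y [F0x _] [F1y _] xy; suff : (F 0%N `&` F 1%N) x by rewrite F01.
  by split => //; move: xy => /= ->.
- by rewrite !imK.
- rewrite imK//; apply: crowded_image.
  + exact: set_val_continuous.
  + exact: set_val_inj.
  + by apply/crowdedP.
Qed.

Lemma image_injK (T U : Type) (f : T -> U) :
  injective f -> forall A : set T, f @^-1` (f @` A) = A.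
Proof.
by move=> injf A; apply/seteqP; split => [x [y Ay /injf <-] //|x Ax]; exists x.
Qed.

(** Here [h] is a closed surjection and [j] an embedding, so pairs move along images and preimages
    under [h], and [j] preserves and reflects crowdedness. *)
Lemma loose_pair_transfer (S B C D : topologicalType)
    (h : S -> B) (g : B -> C) (j : C -> D) :
  compact [set: S] -> compact [set: C] -> hausdorff_space B ->
  hausdorff_space D ->
  continuous h -> continuous g -> continuous j -> injective j ->
  range h = [set: B] ->
  loose_pair g idfun <-> loose_pair (j \o g \o h) h.
Proof.
move=> cS cC hB hD ch cg cj injj surjh; split=> -[P0 [P1]].
  move=> [cP0 cP1 nP01 P01 crP].
  have hK P : h @` (h @^-1` P) = P.
    by apply: image_preimage; rewrite surjh.
  exists (h @^-1` P0), (h @^-1` P1).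
  rewrite -!(image_comp h (j \o g)) !hK -!(image_comp g j) P01; split => //.
  - exact: closed_preimage.
  - exact: closed_preimage.
  - by move=> x y P0x P1y; exact: nP01.
  - by rewrite -P01; exact: crowded_image.
move=> [cP0 cP1 nP01]; rewrite -!(image_comp h (j \o g)) -!(image_comp g j).
move=> P01 crP; exists (h @` P0), (h @` P1); split => //.
- exact: closed_image.
- exact: closed_image.
- by move=> _ _ [x P0x <-] [y P1y <-]; exact: nP01.
- by rewrite -[LHS](image_injK injj) P01 image_injK.
- rewrite -(image_injK injj (g @` (h @` P0))).
  by apply: crowded_preimage => // _ [x _ <-]; exists x.
Qed.

(** * Compactness arguments behind the composition of tight maps *)

Lemma compact_chain_cover (T : topologicalType) (K : set T) (F : set (set T)) :
  compact K -> F !=set0 -> total_on F subset -> (forall V, F V -> open V) ->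
  K `<=` \bigcup_(V in F) V -> exists2 V, F V & K `<=` V.
Proof.
move=> cK F0 Ftot Fop KF.
(* [G] is generated by the tails of the chain; the near-covering form of compactness then gives one
   member containing all of [K]. *)
pose G := filter_from F (fun V => [set V' | F V' /\ V `<=` V']).
have FG : ProperFilter G.
  apply: filter_from_proper; last by move=> V FV; exists V; split.
  apply: filter_from_filter => // V V' FV FV'.
  have [sV|sV] := Ftot _ _ FV FV'.
    by exists V' => // W [FW sW]; split; split => //; exact: subset_trans sW.
  by exists V => // W [FW sW]; split; split => //; exact: subset_trans sW.
have /compact_near_coveringP/(_ _ G (fun V x => V x)) := cK.
case=> [x Kx|V FV sV].
  have [V FV Vx] := KF _ Kx.
  exists (V, [set V' | F V' /\ V `<=` V']); last first.
    by move=> [y V'] /= [Vy [_ sV]]; exact: sV.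
  split => /=; last by exists V.
  by apply: open_nbhs_nbhs; split => //; exact: Fop.
by exists V => //; apply: (sV V); split.
Qed.

(* A minimal closed subset of [P] still covering [Q] has an image without
   isolated points under every map through which [f] factors. *)
Lemma crowded_lift (S A C : topologicalType) (f : S -> A) (k : S -> C)
    (P : set S) (Q : set A) :
  compact [set: S] -> hausdorff_space A -> continuous f -> continuous k ->
  (forall x y, k x = k y -> f x = f y) ->
  closed P -> crowded Q -> Q `<=` f @` P ->
  exists P' : set S, [/\ closed P', P' `<=` P & crowded (k @` P')].
Proof.
move=> cS hA cf ck kf cP crQ QfP.
(* Zorn is applied to the open sets that may be removed from [P]: a maximal [U] leaves a minimal
   closed set. *)
pose ok U := open U /\ Q `<=` f @` (P `\` U).
have [U [[oU QU] maxU]] : exists U, ok U /\ forall V, U `<` V -> ~ ok V.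
  apply: Zorn_bigcup => F Fok Ftot; split.
    by apply: bigcup_open => V /Fok [].
  have [F0|] := pselect (exists V, F V); last first.
    move=> F0; have -> : \bigcup_(X in F) X = set0; last by rewrite setD0.
    by apply/seteqP; split => // x [V FV]; case: F0; exists V.
  (* If the union of the chain removed the whole compact fibre of [P] over [q], a single member
     would already do so. *)
  move=> q Qq; apply: contrapT => noq.
  have cK : compact (P `&` f @^-1` [set q]).
    apply: subclosed_compact cS _ => //; apply: closedI => //.
    apply: closed_preimage => //; apply: accessible_closed_set1.
    exact: hausdorff_accessible.
  have [x [Px fx]|V FV sV] :=
      compact_chain_cover cK F0 Ftot (fun V FV => (Fok V FV).1).
    by apply: contrapT => Vx; apply: noq; exists x.
  have [_ /(_ _ Qq)[x [Px nVx] fx]] := Fok _ FV.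
  by apply: nVx; apply: sV.
have cP' : closed (P `\` U).
  by rewrite setDE; apply: closedI => //; exact: open_closedC.
exists (P `\` U); split; [by []|exact: subDsetl|split].
  by have [[q /QU[x Px _]] _] := crQ; exists (k x), x.
move=> _ V [x [Px nUx] <-]; rewrite nbhsE => -[W [oW Wx] WV].
apply: contrapT => noy.
(* If [k x] is isolated, as witnessed by [W], removing the preimage of [W] as well loses at most the
   value [f x]. That value is a limit of other points of [Q], and the remaining image is closed, so
   [Q] stays covered, against maximality. *)
have kW y : (P `\` U) y -> W (k y) -> k y = k x.
  move=> Py Wy; apply: contrapT => yx; apply: noy; exists (k y); split => //.
  exact: WV.
have oUW : open (U `|` k @^-1` W).
  by apply: openU => //; apply: (continuousP _).1.
have cfW : closed (f @` (P `\` (U `|` k @^-1` W))).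
  by apply: closed_image => //; rewrite setDE; apply: closedI => //;
     exact: open_closedC.
apply: (maxU (U `|` k @^-1` W)).
  by split; [exact: subsetUl|move=> /(_ x) /(_ _)/nUx; apply; right].
have QW q : Q q -> q <> f x -> (f @` (P `\` (U `|` k @^-1` W))) q.
  move=> Qq qx; have [y [Py nUy] yq] := QU _ Qq; exists y => //.
  split => // -[//|/kW]; move=> /(_ (conj Py nUy)) /kf yx.
  by apply: qx; rewrite -yq.
split => // q Qq.
have [qx|] := pselect (q = f x); last exact: QW.
apply: cfW => B qB; have [_ /(_ q B Qq qB)[r [Qr Br rq]]] := crQ.
by exists r; split => //; apply: QW => //; rewrite -qx.
Qed.

(** By regularity a point of [Q] outside [G] has a neighbourhood whose closure misses [G]; the
    closure of the part of [Q] in its interior works. *)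
Lemma crowded_regular (A : topologicalType) (Q G : set A) :
  compact [set: A] -> hausdorff_space A -> closed Q -> crowded Q -> closed G ->
  ~ Q `<=` G ->
  exists Q', [/\ closed Q', crowded Q', Q' `<=` Q & Q' `&` G = set0].
Proof.
move=> cA hA cQ [_ crQ] cG /existsNP[q /not_implyP[Qq nGq]].
have : nbhs q (~` G) by apply: open_nbhs_nbhs; split => //; exact: closed_openC.
have reg : {for q, regular_space A}.
  by apply: (@compact_regular _ _ setT) => //; exact: filterT.
move=> /reg [V qV VG].
have sQ : closure (Q `&` V°) `<=` Q.
  by rewrite [X in _ `<=` X](closure_id _).1//; apply: closureS; exact: subIsetl.
exists (closure (Q `&` V°)); split => //.
- exact: closed_closure.
- split.
    by exists q; apply: subset_closure; split.
  move=> x W clx xW; have [y [[Qy Vy] Wy]] := clx _ (nbhs_interior xW).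
  (* If the approximating point is [x] itself, then [x] lies in [Q] and in the interior of [V], and
     crowdedness of [Q] supplies another point. *)
  have [yx|yx] := pselect (y = x); last first.
    exists y; split => //; last exact: interior_subset.
    by apply: subset_closure; split.
  have [|z [Qz [Vz Wz] zy]] := crQ y (V° `&` W) Qy.
    by apply: filterI; [exact: nbhs_interior|rewrite yx].
  by exists z; rewrite -yx; split => //; apply: subset_closure; split.
- apply/disjoints_subset; apply: subset_trans VG.
  by apply: closureS => x [_]; exact: interior_subset.
Qed.

Lemma loose_pair_split (S A B C : topologicalType)
    (f : S -> A) (k : S -> C) (h : S -> B) :
  compact [set: S] -> compact [set: A] ->
  hausdorff_space A -> hausdorff_space C ->
  continuous f -> continuous k ->
  (forall x y, k x = k y -> f x = f y) ->
  loose_pair f h -> loose_pair f k \/ loose_pair k h.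
Proof.
move=> cS cA hA hC cf ck kf [P0 [P1 [cP0 cP1 hP01 fP01 crP]]].
pose H := k @` P0 `&` k @` P1.
have cH : closed H by apply: closedI; exact: closed_image.
have restr T (g : S -> T) P K : K `<=` g @` P -> g @` (P `&` g @^-1` K) = K.
  move=> sK; apply/seteqP; split => [_ [x [Px Kx] <-]//|y Ky].
  by have [x Px xy] := sK _ Ky; exists x => //; split => //=; rewrite xy.
pose P' := P0 `&` k @^-1` H.
have cP' : closed P' by apply: closedI => //; exact: closed_preimage.
(* The image of [P'] is the image of [H] in [A]. If it is all of the common image, [crowded_lift]
   finds a closed crowded subset of [H], over which both sets are restricted. *)
have [QG|nQG] := pselect (f @` P0 `<=` f @` P').
  right; have [L [cL LP crL]] := crowded_lift cS hA cf ck kf cP' crP QG.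
  have cK : closed (k @` L) by exact: closed_image.
  have KH : k @` L `<=` H by move=> _ [x /LP [_ Hx] <-].
  exists (P0 `&` k @^-1` (k @` L)), (P1 `&` k @^-1` (k @` L)).
  have K0 : k @` L `<=` k @` P0 by move=> x /KH [].
  have K1 : k @` L `<=` k @` P1 by move=> x /KH [].
  rewrite !restr//; split => //.
  - by apply: closedI => //; exact: closed_preimage.
  - by apply: closedI => //; exact: closed_preimage.
  - by move=> x y [P0x _] [P1y _]; exact: hP01.
(* Otherwise a closed crowded [Q'] avoids the image of [H], and over [Q'] the sets have disjoint
   images under [k]. *)
left; have cQ : closed (f @` P0) by exact: closed_image.
have cG : closed (f @` P') by exact: closed_image.
have [Q' [cQ' crQ' Q'Q Q'G]] := crowded_regular cA hA cQ crP cG nQG.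
exists (P0 `&` f @^-1` Q'), (P1 `&` f @^-1` Q').
rewrite !restr -?fP01//; split => //.
- by apply: closedI => //; exact: closed_preimage.
- by apply: closedI => //; exact: closed_preimage.
- move=> y z [Py Qy] [Pz Qz] yz.
  suff : (Q' `&` f @` P') (f y) by rewrite Q'G.
  split => //; exists y => //; split => //; split; first by exists y.
  by exists z.
Qed.

(** * Maps into subspaces and factorization *)

Lemma continuous_set_type (S T : topologicalType) (A : set T)
    (f : S -> set_type A) :
  continuous (set_val \o f) -> continuous f.
Proof.
by move=> /continuousP cf; apply/continuousP => _ [W oW <-]; exact: cf oW.
Qed.

(** [Gamma] evaluates [g] at a chosen point of the fibre. Since [f] is closed, preimages of closed
    sets under [Gamma] are closed. *)
Lemma finer_fiberwise (X Y Z : topologicalType) (f : X -> Y) (g : X -> Z) :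
  compact [set: X] -> hausdorff_space Y -> continuous f -> continuous g ->
  (forall x y, f x = f y -> g x = g y) -> finer f g.
Proof.
move=> cX hY cf cg fg.
pose pt (y : set_type (range f)) := cid2 (set_valP y).
pose Gamma y := to_range g (s2val (pt y)).
have GammaE : to_range g = Gamma \o to_range f.
  apply/funext => x; apply/val_inj => /=; apply: fg.
  by rewrite (s2valP' (pt (to_range f x))).
exists Gamma; split => //; apply/continuous_closedP => C cC.
have -> : Gamma @^-1` C = set_val @^-1` (f @` (to_range g @^-1` C)).
  apply/seteqP; split => [y Cy|y [x Cx xy]].
    by exists (s2val (pt y)) => //; exact: (s2valP' (pt y)).
  have <- : to_range f x = y by apply/set_val_inj.
  by move: Cx; rewrite GammaE.
apply: closed_preimage; first exact: set_val_continuous.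
apply: closed_image => //; apply: closed_preimage => //.
exact: continuous_set_type.
Qed.

(** * Products with the topology of pointwise convergence *)

Section Pointwise.
Variables (I : eqType) (M : topologicalType).

Lemma ptws_eval_continuous (i : I) :
  continuous (fun x : {ptws I -> M} => x i).
Proof. exact: (@proj_continuous I (fun=> M) i). Qed.

Lemma ptws_cvg (F : set_system {ptws I -> M}) (x : {ptws I -> M}) :
  Filter F -> (forall i, (fun y : {ptws I -> M} => y i) @ F --> x i) -> F --> x.
Proof.
move=> FF Fx; apply/cvg_sup => i A [_ [[B oB <-] Bx sB]].
apply: (filterS sB); apply: (Fx i B).
exact: open_nbhs_nbhs.
Qed.

Lemma ptws_continuous (S : topologicalType) (f : S -> {ptws I -> M}) :
  (forall i, continuous (fun s => f s i)) -> continuous f.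
Proof. by move=> cf x; apply: ptws_cvg => i; exact: cf. Qed.

Lemma ptws_compact : compact [set: M] -> compact [set: {ptws I -> M}].
Proof.
move=> cM; have := @tychonoff I (fun=> M) (fun=> setT) (fun=> cM).
by congr compact; apply/seteqP; split.
Qed.

Lemma ptws_hausdorff : hausdorff_space M -> hausdorff_space {ptws I -> M}.
Proof. by move=> hM; exact: (@hausdorff_product I (fun=> M) (fun=> hM)). Qed.

End Pointwise.

(** * Metrics and countable products *)

Section Metric.
Local Open Scope ring_scope.

Lemma metric_ge0 (R : realType) (T : Type) (d : T -> T -> R) :
  (forall x y, d x y = 0 <-> x = y) -> (forall x y, d x y = d y x) ->
  (forall x y z, d x z <= d x y + d y z) -> forall x y, 0 <= d x y.
Proof.
move=> d0 dC dT x y; have := dT x y x; rewrite (dC y x) (d0 x x).2//.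
by rewrite -mulr2n pmulrn_lge0.
Qed.

Lemma metrizable_hausdorff (R : realType) (T : topologicalType) :
  metrizable R T -> hausdorff_space T.
Proof.
move=> [d [d0 dC dT dn]] x y clxy; apply/d0/eqP.
rewrite eq_le (metric_ge0 d0 dC dT) andbT leNgt; apply/negP => xy.
have e0 : 0 < d x y / 2 by rewrite divr_gt0.
have [||z []] := clxy [set z | d x z < d x y / 2] [set z | d y z < d x y / 2].
- by rewrite dn; exists (d x y / 2).
- by rewrite dn; exists (d x y / 2).
by move=> /= xz yz; have := dT x z y; rewrite (dC z y); lra.
Qed.

(** The metric is the supremum of the coordinate distances, each truncated at [p i], which tends to
    zero along the enumeration [phi]. *)
Lemma metrizable_ptws (R : realType) (I : eqType) (M : topologicalType) :
  countable [set: I] -> metrizable R M -> metrizable R {ptws I -> M}.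
Proof.
move=> /countable_injP[phi phi_inj] [d [d0 dC dT dn]].
have d_ge0 := metric_ge0 d0 dC dT.
pose p i : R := (phi i).+1%:R^-1.
have p_gt0 i : 0 < p i by rewrite invr_gt0.
pose t (x y : {ptws I -> M}) i := Num.min (d (x i) (y i)) (p i).
have t_ge0 x y i : 0 <= t x y i by rewrite le_min d_ge0 ltW.
(* The value 0 keeps the set nonempty when [I] is empty. *)
pose E x y := [set r | r = 0 \/ exists i, r = t x y i].
have E_ub x y : has_ubound (E x y).
  exists 1 => _ [->|[i ->]]; first exact: ler01.
  by rewrite ge_min invf_le1// ler1n orbT.
pose D x y := sup (E x y).
have leD x y i : t x y i <= D x y by apply: ub_le_sup => //; right; exists i.
have D_ge0 x y : 0 <= D x y by apply: ub_le_sup => //; left.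
have Dle x y c : 0 <= c -> (forall i, t x y i <= c) -> D x y <= c.
  by move=> c0 tc; apply: ge_sup; [exists 0; left|move=> _ [->|[i ->]]].
have DC x y : D x y = D y x.
  by congr sup; apply/seteqP; split => r [->|[i ->]];
    [left|right; exists i; rewrite /t dC|left|right; exists i; rewrite /t dC].
have DT x y z : D x z <= D x y + D y z.
  apply: Dle => [|i]; first exact: addr_ge0.
  apply: le_trans (lerD (leD x y i) (leD y z i)); rewrite /t.
  have := dT (x i) (y i) (z i); have := d_ge0 (x i) (y i).
  have := d_ge0 (y i) (z i); have := p_gt0 i.
  by rewrite /Num.min; case: ifP; case: ifP; case: ifP; lra.
have Dxx x : D x x = 0.
  apply/eqP; rewrite eq_le D_ge0 andbT; apply: Dle => // i.
  by rewrite /t (d0 _ _).2// ge_min lexx.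
exists D; split => //.
- move=> x y; split => [Dxy|->//]; apply/funext => i; apply/d0/eqP.
  rewrite eq_le d_ge0 andbT; have := leD x y i; rewrite Dxy ge_min.
  by rewrite (leNgt (p i)) p_gt0 orbF.
- move=> x.
  have FB : Filter (nbhs_ball_ (fun y e => [set z | D y z < e]) x).
    apply: filter_from_filter; first by exists 1; exact: ltr01.
    move=> e e' /= e0 e'0; exists (Num.min e e') => /=; first by rewrite lt_min e0.
    by move=> z /=; rewrite lt_min => /andP[].
  apply/seteqP; split => A.
    suff cvx : nbhs_ball_ (fun y e => [set z | D y z < e]) x --> x by exact: cvx.
    apply: ptws_cvg => i B; rewrite dn => -[e /= e0 sB].
    (* Below [p i] the truncation is inactive, so [D] bounds the true distance at [i]. *)
    exists (Num.min e (p i)) => /=; first by rewrite lt_min e0 p_gt0.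
    move=> z /= Dz; apply: sB => /=.
    have := le_lt_trans (leD x z i) Dz.
    rewrite lt_min /t !gt_min ltxx orbF => /andP[/orP[//|pe] dp].
    exact: lt_trans dp pe.
  move=> [e /= e0 sA]; apply: (filterS sA).
  (* Coordinates with [phi i] above [n] are truncated below [e / 2]; only finitely many others need
     a neighbourhood. *)
  have [n ne] : exists n : nat, (n.+1%:R^-1 : R) < e / 2.
    have [|n] := @ltr_add_invr R 0 (e / 2); first by rewrite divr_gt0.
    by rewrite add0r; exists n.
  have near_small m : nbhs x [set z : {ptws I -> M} |
      forall i, (phi i < m)%N -> d (x i) (z i) < e / 2].
    elim: m => [|m IH].
      by rewrite (_ : [set _ | _] = setT); [exact: filterT|apply/seteqP; split].
    have [[i im]|noi] := pselect (exists i, phi i = m).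
      have : nbhs x [set z : {ptws I -> M} | d (x i) (z i) < e / 2].
        apply: (@ptws_eval_continuous I M i x [set m | d (x i) m < e / 2]) => /=.
        by rewrite dn; exists (e / 2) => //=; rewrite divr_gt0.
      apply: filterS2 IH => z zm zi j; rewrite ltnS leq_eqVlt => /orP[/eqP jm|].
        suff -> : j = i by [].
        by apply: phi_inj; rewrite ?inE// jm im.
      exact: zm.
    apply: filterS IH => z zm j; rewrite ltnS leq_eqVlt => /orP[/eqP jm|].
      by case: noi; exists j.
    exact: zm.
  apply: filterS (near_small n.+1) => z zn /=.
  apply: (@le_lt_trans _ _ (e / 2)); last by lra.
  apply: Dle => [|i]; first by lra.
  rewrite ge_min; have [/zn/ltW->//|ni] := ltnP (phi i) n.+1.
  apply/orP; right; apply: le_trans (ltW ne).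
  by rewrite lef_pV2 ?posrE// ler_nat ltnW// ltnS.
Qed.

End Metric.

Lemma loose_pair_ker (S A B B' : topologicalType) (f : S -> A)
    (h : S -> B) (h' : S -> B') :
  (forall x y, h' x = h' y -> h x = h y) -> loose_pair f h -> loose_pair f h'.
Proof.
move=> hh' [P0 [P1 [cP0 cP1 nP01 P01 crP]]]; exists P0, P1; split => //.
by move=> x y P0x P1y /hh'; exact: nP01.
Qed.

(** * Well orders and the first uncountable ordinal *)

Section WellOrder.
Context {d : Order.disp_t} {W : orderType d}.

Lemma well_order_ind (P : W -> Prop) :
  well_order (@Order.le d W) ->
  (forall b, (forall c, (c < b)%O -> P c) -> P b) -> forall b, P b.
Proof.
move=> wo IH b; apply: contrapT => nPb.
have [|z [[/asboolP nPz zmin] _]] := wo [pred c | `[< ~ P c >]].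
  by exists b; apply/asboolP.
apply: nPz; apply: IH => c cz; apply: contrapT => nPc.
have : (z <= c)%O by apply: zmin; apply/asboolP.
by rewrite leNgt cz.
Qed.

(** Otherwise the segment below [w] would be a countable union of countable segments. *)
Lemma omega1_ub (w : W) (c : nat -> W) : is_omega1 w ->
  (forall n, c n < w)%O -> exists2 a, (a < w)%O & forall n, (c n <= a)%O.
Proof.
move=> [unc cnt] cw; apply: contrapT => noa; apply: unc.
apply: (@sub_countable _ _ _ (\bigcup_(n in [set: nat]) [set b | (b < c n)%O])).
  apply: subset_card_le => b /= bw; apply: contrapT => nob; apply: noa.
  exists b => // n; rewrite leNgt; apply/negP => bn; apply: nob.
  by exists n.
by apply: bigcup_countable => // n _; exact: cnt.
Qed.

(** Otherwise the segment below [w] would be the countable segment below [i] together with [i]. *)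
Lemma omega1_limit (w i : W) : is_omega1 w -> (i < w)%O ->
  exists2 c, (c < w)%O & (i < c)%O.
Proof.
move=> [unc cnt] iw; apply: contrapT => noc; apply: unc.
pose F (t : bool) := if t then [set b | (b < i)%O] else [set i].
apply: (@sub_countable _ _ _ (\bigcup_(t in [set: bool]) F t)).
  apply: subset_card_le => b /= bw; case: (ltgtP b i) => [bi|ib|->].
  - by exists true.
  - by case: noc; exists b.
  - by exists false.
by apply: bigcup_countable => // -[] _ /=; [exact: cnt|exact: countable1].
Qed.

End WellOrder.

(** * Projections of a closed subset of an ordinal power *)

Section Levels.
Context {d : Order.disp_t} {W : orderType d}.
Variables (M : topologicalType) (w : W).
Hypotheses (M_compact : compact [set: M]) (M_hausdorff : hausdorff_space M).

Lemma ordpow_compact (a : W) : compact [set: ordpow M a].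
Proof. exact: (@ptws_compact {b : W | (b < a)%O} M). Qed.

Lemma ordpow_hausdorff (a : W) : hausdorff_space (ordpow M a).
Proof. exact: (@ptws_hausdorff {b : W | (b < a)%O} M). Qed.

Lemma ordpow_eval_continuous (a : W) (i : seg a) :
  continuous (fun x : ordpow M a => x i).
Proof. exact: (@ptws_eval_continuous {b : W | (b < a)%O} M). Qed.

Lemma ordproj_continuous (a b : W) (le_ab : (a <= b)%O) :
  continuous (@ordproj _ _ M _ _ le_ab).
Proof.
apply: (@ptws_continuous {c : W | (c < a)%O} M) => i.
exact: ordpow_eval_continuous.
Qed.

Lemma ordproj_trans (a b c : W) (le_ab : (a <= b)%O) (le_bc : (b <= c)%O)
    (le_ac : (a <= c)%O) (x : ordpow M c) :
  ordproj le_ab (ordproj le_bc x) = ordproj le_ac x.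
Proof. by apply/funext => i; congr (x _); exact/val_inj. Qed.

Lemma ordproj_eqP (a b : W) (le_ab : (a <= b)%O) (x y : ordpow M b) :
  ordproj le_ab x = ordproj le_ab y <->
  forall i : seg b, (sval i < a)%O -> x i = y i.
Proof.
split=> [E i ia|E]; last by apply/funext => i; apply: E; exact: (svalP i).
have := congr1 (@^~ (exist _ (sval i) ia)) E; rewrite /ordproj/=.
by have -> : widen_seg le_ab (exist _ (sval i) ia) = i by exact/val_inj.
Qed.

Lemma open_separated (b c : W) :
  open [set p : ordpow M b * ordpow M b |
    exists2 i : seg b, (sval i < c)%O & p.1 i <> p.2 i].
Proof.
rewrite openE => -[x y] /= [i ic xy].
move: M_hausdorff; rewrite open_hausdorff => /(_ (x i) (y i)).
move=> [|[A B] /= [xA yB] [oA oB /eqP AB]]; first exact/eqP.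
exists ([set z : ordpow M b | A (z i)], [set z : ordpow M b | B (z i)]).
  split => /=; apply: ordpow_eval_continuous; apply: open_nbhs_nbhs; split => //.
    by rewrite inE in xA.
  by rewrite inE in yB.
move=> [z t] /= [Az Bt]; exists i => //= zt.
suff : (A `&` B) (z i) by rewrite AB.
by split => //; rewrite zt.
Qed.

(* Compactness turns separation by coordinates below a limit [b] into separation
   by coordinates below some [c < b]. *)
Lemma compact_separated (b : W) (K : set (ordpow M w * ordpow M w)) :
  compact K -> (exists a, (a < b)%O) ->
  (forall i, (i < b)%O -> exists2 c, (c < b)%O & (i < c)%O) ->
  (forall p, K p -> exists2 i : seg w, (sval i < b)%O & p.1 i <> p.2 i) ->
  exists2 c, (c < b)%O & forall p, K p ->
    exists2 i : seg w, (sval i < c)%O & p.1 i <> p.2 i.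
Proof.
move=> cK [a ab] blim Ksep.
pose O c := [set p : ordpow M w * ordpow M w |
    exists2 i : seg w, (sval i < c)%O & p.1 i <> p.2 i].
have [||||_ [c cb <-] KO] := @compact_chain_cover _ K (O @` [set c | (c < b)%O]) cK.
- by exists (O a), a.
- move=> _ _ [c _ <-] [c' _ <-].
  by have [cc|cc] := leP c c'; [left|right] => p [i ic pi]; exists i => //;
    [exact: lt_le_trans cc|exact: lt_trans cc].
- by move=> _ [c _ <-]; exact: open_separated.
- move=> p /Ksep [i ib pi]; have [c cb ic] := blim _ ib.
  by exists (O c); [exists c|exists i].
by exists c.
Qed.

Variable X : set (ordpow M w).
Hypothesis X_closed : closed X.

(** The codomain is the full power, not the level, so that all levels are compared through maps on
    the single compact space [X]. *)
Definition subproj (a : W) (le_aw : (a <= w)%O) (x : set_type X) : ordpow M a :=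
  ordproj le_aw (set_val x).

Lemma subproj_continuous (a : W) (le_aw : (a <= w)%O) : continuous (subproj le_aw).
Proof.
move=> x; apply: (@continuous_comp _ _ _ set_val (ordproj le_aw)).
  exact: set_val_continuous.
exact: ordproj_continuous.
Qed.

Lemma subproj_le (a b : W) (le_aw : (a <= w)%O) (le_bw : (b <= w)%O) x y :
  (a <= b)%O -> subproj le_bw x = subproj le_bw y -> subproj le_aw x = subproj le_aw y.
Proof.
move=> ab /ordproj_eqP E; apply/ordproj_eqP => i ia.
by apply: E; exact: lt_le_trans ab.
Qed.

Lemma subproj_inj (le_ww : (w <= w)%O) : injective (subproj le_ww).
Proof.
move=> x y /ordproj_eqP E; apply: set_val_inj; apply/funext => i.
by apply: E; exact: (svalP i).
Qed.

Lemma subspace_compact : compact [set: set_type X].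
Proof.
apply: compact_set_type.
exact: subclosed_compact X_closed (@ordpow_compact w) _.
Qed.

Lemma subspace_hausdorff : hausdorff_space (set_type X).
Proof.
apply: (hausdorff_inj (@set_val_continuous _ X)); first exact: set_val_inj.
exact: ordpow_hausdorff.
Qed.

Lemma level_compact (a : W) (le_aw : (a <= w)%O) :
  compact [set: set_type (level X le_aw)].
Proof.
apply: compact_set_type; apply: continuous_compact.
  by apply: continuous_subspaceT; exact: ordproj_continuous.
exact: subclosed_compact X_closed (@ordpow_compact w) _.
Qed.

Lemma level_hausdorff (a : W) (le_aw : (a <= w)%O) :
  hausdorff_space (set_type (level X le_aw)).
Proof.
apply: (hausdorff_inj (@set_val_continuous _ _)); first exact: set_val_inj.
exact: ordpow_hausdorff.
Qed.

(** [loose_pair_transfer] applies to [X] mapped onto its level [b] and to the inclusion of level [a]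
    into the full power. *)
Lemma tight_level_projP (a b : W) (le_ab : (a <= b)%O) (le_bw : (b <= w)%O)
    (le_aw : (a <= w)%O) :
  tight (level_proj X le_ab le_bw) <-> ~ loose_pair (subproj le_aw) (subproj le_bw).
Proof.
have cg : continuous (level_proj X le_ab le_bw).
  apply: continuous_set_type => x.
  apply: (@continuous_comp _ _ _ set_val (ordproj le_ab)).
    exact: set_val_continuous.
  exact: ordproj_continuous.
rewrite tightP//; [|exact: level_compact|exact: level_hausdorff].
pose h (x : set_type X) : set_type (level X le_bw) :=
  SigSub (mem_set (imageP (ordproj le_bw) (set_valP x))).
have ch : continuous h by apply: continuous_set_type; exact: subproj_continuous.
rewrite (@loose_pair_transfer _ _ _ _ h _ set_val subspace_compact) //; last first.
- apply/seteqP; split => // y _; have [x Xx xy] := set_valP y.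
  by exists (SigSub (mem_set Xx)) => //; exact/val_inj.
- exact: set_val_continuous.
- exact: ordpow_hausdorff.
- exact: level_hausdorff.
- exact: level_compact.
have -> : set_val \o level_proj X le_ab le_bw \o h = subproj le_aw.
  by apply/funext => x; exact: ordproj_trans.
split; apply: contra_not; apply: loose_pair_ker => x y.
  by move=> /(congr1 set_val).
by move=> E; exact: set_val_inj.
Qed.

Lemma not_loose_pair_subproj
    (W_wo : well_order (@Order.le d W))
    (X_tight : forall (a s : W) (le_as : (a <= s)%O) (le_sw : (s <= w)%O),
      (a < w)%O -> is_succ a s -> tight (level_proj X le_as le_sw))
    (a b : W) (le_aw : (a <= w)%O) (le_bw : (b <= w)%O) :
  (a < b)%O -> ~ loose_pair (subproj le_aw) (subproj le_bw).
Proof.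
move: b a le_aw le_bw; apply: (well_order_ind W_wo) => b IH a le_aw le_bw ab.
have [[c [cb cmin]]|nsucc] := pselect (exists c, is_succ c b).
  have cw : (c < w)%O := lt_le_trans cb le_bw.
  have nl : ~ loose_pair (subproj (ltW cw)) (subproj le_bw).
    by apply/(tight_level_projP (ltW cb)); apply: X_tight.
  have [ac|ca|E] := ltgtP a c.
  - move=> /(loose_pair_split (k := subproj (ltW cw))).
    case=> //; last by exact: IH.
    + exact: subspace_compact.
    + exact: ordpow_compact.
    + exact: ordpow_hausdorff.
    + exact: ordpow_hausdorff.
    + exact: subproj_continuous.
    + exact: subproj_continuous.
    + by move=> x y; apply: subproj_le; exact: ltW.
  - by have := cmin _ ca; rewrite leNgt ab.
  - by move: le_aw; rewrite E => le_cw; rewrite (eq_irrelevance le_cw (ltW cw)).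
(* Not being a successor, [b] is a limit: with nothing between [i] and [b], it would be the
   successor of [i]. *)
have blim i : (i < b)%O -> exists2 c, (c < b)%O & (i < c)%O.
  move=> ib; apply: contrapT => noc; apply: nsucc; exists i; split => // c ic.
  by rewrite leNgt; apply/negP => cb; apply: noc; exists c.
move=> [P0 [P1 [cP0 cP1 nP01 P01 crP]]].
pose K := (set_val @` P0) `*` (set_val @` P1).
have cK : compact K.
  by apply: compact_setX; (apply: continuous_compact;
    [apply: continuous_subspaceT; exact: set_val_continuous|
     apply: subclosed_compact subspace_compact _]).
have [p [[x P0x xp] [y P1y yp]]|c cb Kc] :=
    compact_separated cK (ex_intro _ a ab) blim.
  apply: contrapT => noi; apply: (nP01 _ _ P0x P1y); apply/ordproj_eqP => i ib.
  by apply: contrapT => xyi; apply: noi; exists i; rewrite // -xp -yp.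
(* The separating level [c] may lie at or below [a], while the induction hypothesis needs a level
   above [a]; hence the maximum with [c']. *)
have [c' c'b ac'] := blim _ ab.
have eb : (Order.max c c' < b)%O by rewrite gt_max cb c'b.
have ew : (Order.max c c' <= w)%O := le_trans (ltW eb) le_bw.
apply: (IH _ eb a le_aw ew); first by rewrite lt_max ac' orbT.
exists P0, P1; split => // x y P0x P1y /ordproj_eqP E.
have [|i ic] := Kc (set_val x, set_val y).
  by split; [exists x|exists y].
by apply; apply: E; rewrite lt_max ic.
Qed.

(** For each [n], the pairs whose [g]-values are at least [1/(n+1)] apart form a compact set off the
    diagonal, so coordinates below some [c n] separate them; [a] bounds all [c n]. *)
Lemma continuous_factor_subproj (R : realType) (Z : topologicalType)
    (g : set_type X -> Z) :
  is_omega1 w -> metrizable R Z -> continuous g ->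
  exists2 a, (a < w)%O & forall (le_aw : (a <= w)%O) x y,
    subproj le_aw x = subproj le_aw y -> g x = g y.
Proof.
move=> w1 [dZ [d0 dC dT dn]] cg.
have step n : exists c, (c < w)%O /\ forall x y,
    (forall i : seg w, (sval i < c)%O -> set_val x i = set_val y i) ->
    (dZ (g x) (g y) < n.+1%:R^-1)%R.
  pose K : set (set_type X * set_type X) :=
    [set p | ~ (dZ (g p.1) (g p.2) < n.+1%:R^-1)%R].
  have cK : closed K.
    apply: open_closedC; rewrite openE => -[x y] /= xy.
    (* Half the gap, since both endpoints may move by [e]. *)
    pose e := ((n.+1%:R^-1 - dZ (g x) (g y)) / 2)%R.
    have e0 : (0 < e)%R by rewrite divr_gt0// subr_gt0.
    exists ([set x' | (dZ (g x) (g x') < e)%R], [set y' | (dZ (g y) (g y') < e)%R]).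
      split => /=.
        by apply: (cg x [set z | dZ (g x) z < e]%R) => /=; rewrite dn; exists e.
      by apply: (cg y [set z | dZ (g y) z < e]%R) => /=; rewrite dn; exists e.
    move=> [x' y'] /= [xx' yy'].
    have := dT (g x') (g x) (g y'); have := dT (g x) (g y) (g y').
    by rewrite (dC (g x') (g x)); move: xx' yy'; rewrite /e;
      move: (n.+1%:R^-1)%R => r; lra.
  pose vv (p : set_type X * set_type X) := (set_val p.1, set_val p.2).
  have cvK : compact (vv @` K).
    apply: continuous_compact.
      apply: continuous_subspaceT => -[x y].
      apply: (@cvg_pair _ _ _ _ (nbhs (set_val x)) (nbhs (set_val y))).
        by apply: continuous_comp; [exact: cvg_fst|exact: set_val_continuous].
      by apply: continuous_comp; [exact: cvg_snd|exact: set_val_continuous].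
    apply: subclosed_compact cK (compact_setX subspace_compact subspace_compact) _.
    by move=> p _.
  have [|i iw|p [[x y] /= Kp <-]|c cw cP] := @compact_separated w _ cvK.
  - apply: contrapT => now; case: w1 => unc _; apply: unc.
    have -> : [set b | (b < w)%O] = set0; last exact: countable0.
    by apply/seteqP; split => // b bw; apply: now; exists b.
  - exact: omega1_limit.
  - apply: contrapT => noi; apply: Kp.
    have -> : x = y; last by rewrite (d0 _ _).2// invr_gt0.
    apply: set_val_inj; apply/funext => i; apply: contrapT => xyi.
    by apply: noi; exists i => //; exact: (svalP i).
  exists c; split => // x y E; apply: contrapT => nxy.
  have [|i ic] := cP (set_val x, set_val y); first by exists (x, y).
  by apply; exact: E.
have [c cP] := choice step.
have [a aw ca] := omega1_ub w1 (fun n => (cP n).1).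
exists a => // le_aw x y /ordproj_eqP E; apply/d0/eqP.
rewrite eq_le (metric_ge0 d0 dC dT) andbT leNgt; apply/negP => /ltr_add_invr[n].
rewrite add0r ltNge => /negP; apply; apply/ltW/(cP n).2 => i ic.
by apply: E; exact: lt_le_trans (ca n).
Qed.

End Levels.

Theorem theorem6p2 (R : realType)
    (d : Order.disp_t) (W : orderType d)
    (W_wo : well_order (@Order.le d W))
    (w1 : W) (w1_omega1 : is_omega1 w1)
    (M : topologicalType)
    (M_compact : compact [set: M]) (M_metrizable : metrizable R M)
    (X : set (ordpow M w1)) (X_closed : closed X)
    (X_tight : forall (a s : W) (le_as : (a <= s)%O) (le_sw : (s <= w1)%O),
      (a < w1)%O -> is_succ a s -> tight (level_proj X le_as le_sw)) :
  (forall (a b : W) (le_ab : (a <= b)%O) (le_bw : (b <= w1)%O),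
      (a < b)%O -> tight (level_proj X le_ab le_bw)) /\
  dissipated R (set_type X).
Proof.
have M_hausdorff := metrizable_hausdorff M_metrizable.
split => [a b le_ab le_bw ab|].
  apply/(tight_level_projP M_compact M_hausdorff X_closed le_ab le_bw
    (le_trans le_ab le_bw)).
  exact: not_loose_pair_subproj.
split; [exact: subspace_compact|exact: subspace_hausdorff|move=> Z g cZ mZ cg].
have [a aw ga] := continuous_factor_subproj M_compact M_hausdorff X_closed
  w1_omega1 mZ cg.
(* The full power serves as the metrizable target: [a] has only countably many predecessors. *)
exists (ordpow M a), (@subproj _ _ M w1 X a (ltW aw)); split.
- exact: ordpow_compact.
- apply: (@metrizable_ptws R {b : W | (b < a)%O} M) => //.
  have /countable_injP[f injf] := w1_omega1.2 _ aw.
  apply/countable_injP; exists (f \o sval) => x y _ _ /= /injf E.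
  by apply/val_inj/E; rewrite inE; [exact: (svalP x)|exact: (svalP y)].
- exact: subproj_continuous.
- apply/tightP => //.
  + exact: subspace_compact.
  + exact: ordpow_hausdorff.
  + exact: subproj_continuous.
  (* The projection to level [w1] is injective, so a loose pair for the chosen map is one between
     the levels [a] and [w1]. *)
  move=> lp; have := not_loose_pair_subproj M_compact M_hausdorff X_closed W_wo
    X_tight (le_aw := ltW aw) (le_bw := lexx w1) aw.
  apply.
  by apply: loose_pair_ker lp => x y /subproj_inj.
- apply: finer_fiberwise => //.
  + exact: subspace_compact.
  + exact: ordpow_hausdorff.
  + exact: subproj_continuous.
  + exact: ga.
Qed.
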